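(* Let $K$ be a field of characteristic zero, let $n\ge 2$, let $C\in K[x_1,\ldots,x_{n+1}]$ be an arbitrary polynomial, and let $c$ be a minimal root of $C$. Then $Z(P_C[x_1,\ldots,x_{n+1}])=K[c]$.
   Context: $P_C[x_1,\ldots,x_{n+1}]$ denotes the $n$-Lie-Poisson algebra given by the polynomial algebra $K[x_1,\ldots,x_{n+1}]$ with the $n$-ary bracket $\{f_1,\ldots,f_n\}=J(f_1,\ldots,f_n,C)$, where $J(g_1,\ldots,g_{n+1})=\det[\partial g_i/\partial x_j]$ is the Jacobian. Its center $Z(P_C[x_1,\ldots,x_{n+1}])$ is the set of all $g\in K[x_1,\ldots,x_{n+1}]$ such that $\{g,f_2,\ldots,f_n\}=0$ for all $f_2,\ldots,f_n\in K[x_1,\ldots,x_{n+1}]$. A polynomial $g\in K[x_1,\ldots,x_{n+1}]$ is called a root of $f\in K[x_1,\ldots,x_{n+1}]$ if $f\in K[g]$. A root of $f$ of minimal degree is called a minimal root of $f$.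
   Formalization: C is assumed nonconstant: for constant C the bracket is zero, so the center is all of K[x_1,…,x_{n+1}], while a minimal root c of C is a constant and K[c] = K, so the claim fails for every constant C. *)

(* Defs.v *)
(** Mathematical Components, with multivariate polynomials from multinomials. *)
From HB Require Import structures.
From mathcomp Require Import all_boot all_order all_algebra.
From mathcomp Require Import mpoly.

Set Implicit Arguments.
Unset Strict Implicit.
Unset Printing Implicit Defensive.

Import GRing.Theory.
Local Open Scope ring_scope.

Section Defs.
Variables (K : fieldType) (n : nat).
Implicit Types (C c f g : {mpoly K[n.+1]}).

Definition jacobian (g : 'I_n.+1 -> {mpoly K[n.+1]}) : {mpoly K[n.+1]} :=
  \det (\matrix_(i < n.+1, j < n.+1) (g i)^`M(j)).

(** [{f_1, ..., f_n} = J(f_1, ..., f_n, C)]: [C] is in the last row, since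
    [unlift ord_max i] is [Some] of [i] seen in ['I_n] if [i < n], and [None]
    if [i = n]. *)
Definition nbracket C (f : 'I_n -> {mpoly K[n.+1]}) : {mpoly K[n.+1]} :=
  jacobian (fun i => if unlift ord_max i is Some j then f j else C).

(** [g] fills the first slot, so only the values of [f] at nonzero indices
    (which are [f_2, ..., f_n]) matter. *)
Definition in_center C g : Prop :=
  forall f : 'I_n -> {mpoly K[n.+1]},
    nbracket C (fun i => if i == 0%N :> nat then g else f i) = 0.

(** [f \in K[g]] *)
Definition in_subalg g f : Prop := exists p : {poly K}, f = horner_alg g p.

Definition is_root_of g f : Prop := in_subalg g f.

(** [msize] is the total degree plus one, and [0] at the zero polynomial. *)
Definition is_minimal_root_of g f : Prop :=
  is_root_of g f /\ forall h, is_root_of h f -> (msize g <= msize h)%N.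

End Defs.

(* Main.v *)
Require Import Defs.
From HB Require Import structures.
From mathcomp Require Import all_boot all_order all_algebra.
From mathcomp Require Import fingroup perm mpoly.
From Stdlib Require Import Classical.

Set Implicit Arguments.
Unset Strict Implicit.
Unset Printing Implicit Defensive.

Import GRing.Theory.
Local Open Scope ring_scope.

(** Taking variables for the free slots of the bracket shows that [g] is in the
    center exactly when the wedge of [dg] and [dC] vanishes ([in_centerP]). Such
    [g] form a subalgebra [A] of [K[x]], and the point is that [A] is generated
    by a single polynomial [h] ([dependent_monogenic]). This settles the claim:
    [h] is a root of [C], as [C] is in [A], so the degree of the minimal root [c]
    is at most that of [h]; but [c] is in [A], hence a polynomial in [h], and by
    degrees this polynomial is affine, so [K[c] = K[h]].

    The generator comes from an argument in the style of Lueroth's theorem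
    ([subalgebra_monogenic]). Choose a line along which the derivative of [C] is
    not identically zero. An element of [A] is determined by its
    restriction to this line ([line_inj_dependent]), so [A] embeds in [K[t]]. Let
    [h] be a nonconstant element of [A] whose restriction has the least degree, and
    let [D] be the minimal polynomial of [t] over the field of fractions of [A].
    It divides [h(X) - h], where [h(X)] is the restriction of [h] to the line in a
    new variable [X]. A nonconstant coefficient of [D] is an element of [A], so
    its degree is at least that of [h]; this forces [D] to be [h(X) - h] up to a
    constant. So [h(X) - h] divides [g(X) - g] for every [g] in [A], and reducing
    [g(X)] modulo [h(X) - h] exhibits [g] as a polynomial in [h].

    That the coefficients of [D] are in [A] and not just fractions needs a form
    of Gauss's lemma over [K[x]] ([mpoly_monic_factor]). It is reduced to
    univariate polynomials over a field by the dilations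
    [f(p + s (x - p))]: a quotient that is a polynomial in [s] over [K(x)], with a
    denominator whose value at [s = 0] is a nonzero constant, has coefficients in
    [K[x]], and one may set [s = 1]. *)

(** * Restriction of multivariate polynomials to coordinate lines *)

Lemma mpoly_ring_ind (n : nat) (R : nzRingType) (P : {mpoly R[n]} -> Prop) :
  (forall a, P a%:MP) -> (forall i, P 'X_i) ->
  (forall f g, P f -> P g -> P (f + g)) ->
  (forall f g, P f -> P g -> P (f * g)) -> forall f, P f.
Proof.
move=> PC PX PD PM; elim/mpolyind => [|a m f _ _ Pf].
  by rewrite -mpolyC0.
apply: (PD) => //; rewrite -mul_mpolyC; apply: (PM) => //.
rewrite mpolyXE_id; apply: big_ind => [||i _]; first by rewrite -mpolyC1.
  exact: PM.
elim: (m i) => [|k IHk]; first by rewrite expr0 -mpolyC1.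
by rewrite exprS; exact: PM.
Qed.

Lemma mderiv_var (n : nat) (R : nzRingType) (i j : 'I_n) :
  ('X_j : {mpoly R[n]})^`M(i) = (j == i)%:R.
Proof.
rewrite mderivX mnm1E; case: eqVneq => [->|_]; last by rewrite scale0r.
by rewrite -[X in (X - _)%MM]add0m addmK mpolyX0 scale1r.
Qed.

Section Lines.
Variables (K : fieldType) (n : nat).
Implicit Types (f g : {mpoly K[n]}) (p : 'I_n -> K) (i j : 'I_n).

(** The restriction to the line through [p] parallel to the [i]-th axis. *)
Definition line p i : {mpoly K[n]} -> {poly K} :=
  mmap polyC (fun j => (p j)%:P + (j == i)%:R *: 'X).

HB.instance Definition _ p i := GRing.RMorphism.on (line p i).

Lemma lineC p i a : line p i a%:MP = a%:P.
Proof. exact: mmapC. Qed.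

Lemma lineX p i j : line p i 'X_j = (p j)%:P + (j == i)%:R *: 'X.
Proof. by rewrite /line mmapX mmap1U. Qed.

Lemma deriv_line p i f : (line p i f)^`() = line p i f^`M(i).
Proof.
elim/mpoly_ring_ind: f => [a|j|f g Hf Hg|f g Hf Hg].
- by rewrite lineC derivC mderivC rmorph0.
- rewrite lineX derivD derivC derivZ derivX add0r.
  by rewrite mderiv_var rmorph_nat scaler_nat.
- by rewrite mderivD !rmorphD /= derivD Hf Hg.
- by rewrite mderivM rmorphD !rmorphM /= derivM Hf Hg.
Qed.

Lemma horner_line p i f t :
  (line p i f).[t] = f.@[fun j => p j + (j == i)%:R * t].
Proof.
elim/mpoly_ring_ind: f => [a|j|f g Hf Hg|f g Hf Hg].
- by rewrite lineC hornerC mevalC.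
- by rewrite lineX mevalXU !hornerE.
- by rewrite mevalD rmorphD hornerD Hf Hg.
- by rewrite mevalM rmorphM hornerM Hf Hg.
Qed.

Lemma horner_line0 p i f : (line p i f).[0] = f.@[p].
Proof.
by rewrite horner_line; apply: meval_eq => j; rewrite mulr0 addr0.
Qed.

Lemma msize_mderiv_ltn i f k : (msize f <= k.+1 -> msize f^`M(i) <= k)%N.
Proof.
move=> le_fk; rewrite msizeE; apply/bigmax_leqP_seq => m.
rewrite mcoeff_msupp mcoeff_deriv => m_f _.
have : (m + U_(i))%MM \in msupp f.
  by rewrite mcoeff_msupp; apply: contraNneq m_f => ->; rewrite mul0rn.
move/msize_mdeg_lt; rewrite mdegD mdeg1 addn1 => lt_m.
by have := leq_trans lt_m le_fk.
Qed.

Hypothesis charK0 : [pchar K] =i pred0.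

Lemma mderiv_eq0_const f : (forall i, f^`M(i) = 0) -> f = (f@_0)%:MP.
Proof.
move=> df0; apply/mpolyP => m; rewrite mcoeffC.
case: eqVneq => [->|m_neq0]; first by rewrite mulr1.
rewrite mulr0; apply/eqP/negP => /negP fm.
have [i mi] : exists i, m i != 0%N.
  apply/existsP; apply: contraNT m_neq0; rewrite negb_exists => /forallP m0.
  by apply/eqP/mnmP => i; rewrite mnm0E; apply/eqP; have := m0 i; rewrite negbK.
have := congr1 (mcoeff (m - U_(i))) (df0 i).
rewrite mcoeff_deriv mcoeff0 submK ?lep1mP // => /eqP.
rewrite -mulr_natr mulf_eq0 (negPf fm) /=.
by rewrite (pcharf0P K).1.
Qed.

Lemma poly_char0_eq0 (q : {poly K}) : (forall t, q.[t] = 0) -> q = 0.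
Proof.
move=> q0; apply: contraTeq isT => q_neq0.
pose s := [seq (k%:R : K) | k <- iota 0 (size q)].
have : (size s < size q)%N.
  apply: max_poly_roots => //; first by apply/allP => t _; apply/rootP.
  rewrite map_inj_uniq ?iota_uniq // => a b /eqP.
  wlog le_ab : a b / (a <= b)%N => [hw|].
    by case: (leqP a b) => [/hw //|/ltnW/hw h /eqP e]; apply/esym/h/eqP.
  rewrite eq_sym -subr_eq0 -natrB // (pcharf0P K).1 // subn_eq0 => le_ba.
  by apply/eqP; rewrite eqn_leq le_ab.
by rewrite size_map size_iota ltnn.
Qed.

(** Such an [f] vanishes identically on every line parallel to a coordinate
    axis, hence so do its partial derivatives, which have smaller degree. *)
Lemma meval_eq0 f : (forall p, f.@[p] = 0) -> f = 0.
Proof.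
elim: {f}(msize f) {-2}f (leqnn (msize f)) => [|k IHk] f le_fk f0.
  by apply/eqP; rewrite -msize_poly_eq0 -leqn0.
have f_const : f = (f@_0)%:MP.
  apply: mderiv_eq0_const => i.
  apply: IHk => [|p]; first exact: msize_mderiv_ltn.
  rewrite -(horner_line0 p i) -deriv_line.
  rewrite (_ : line p i f = 0) ?deriv0 ?horner0 //.
  by apply: poly_char0_eq0 => t; rewrite horner_line.
have f00 : f@_0 = 0 by rewrite -[LHS](@mevalC n _ (fun=> 0)) -f_const.
by rewrite f_const f00 mpolyC0.
Qed.

Lemma meval_neq0 f : f != 0 -> exists p, f.@[p] != 0.
Proof.
move=> /eqP f_neq0; apply: NNPP => f0; apply: f_neq0; apply: meval_eq0 => p.
by apply: NNPP => /eqP fp; apply: f0; exists p.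
Qed.

End Lines.

(** * Polynomials whose gradient is dependent on a given one *)

Section DependentGradients.
Variables (K : fieldType) (n : nat) (C : {mpoly K[n]}).
Implicit Types f g h : {mpoly K[n]}.

(** The vanishing of all the 2 x 2 minors of the matrix with rows the gradients
    of [g] and [C]: the wedge of [dg] and [dC] is zero. *)
Definition gradients_dependent : {pred {mpoly K[n]}} :=
  fun g => [forall i, forall j, g^`M(i) * C^`M(j) == g^`M(j) * C^`M(i)].

Lemma gradients_dependentP g :
  reflect (forall i j, g^`M(i) * C^`M(j) = g^`M(j) * C^`M(i))
          (g \in gradients_dependent).
Proof. exact: (iffP 'forall_'forall_eqP). Qed.

Lemma gradients_dependent_refl : C \in gradients_dependent.
Proof. by apply/gradients_dependentP => i j; rewrite mulrC. Qed.

Lemma gradients_dependent_subring_closed :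
  GRing.subring_closed gradients_dependent.
Proof.
split=> [|f g|f g].
- by apply/gradients_dependentP => i j; rewrite -mpolyC1 !mderivC !mul0r.
- move=> /gradients_dependentP fC /gradients_dependentP gC.
  by apply/gradients_dependentP => i j; rewrite !mderivB !mulrBl fC gC.
- move=> /gradients_dependentP fC /gradients_dependentP gC.
  apply/gradients_dependentP => i j; rewrite !mderivM !mulrDl.
  by rewrite -!(mulrA f) gC !(mulrAC _ g) fC.
Qed.

HB.instance Definition _ :=
  GRing.isSubringClosed.Build {mpoly K[n]} gradients_dependent
    gradients_dependent_subring_closed.

Lemma gradients_dependent_const a : a%:MP \in gradients_dependent.
Proof. by apply/gradients_dependentP => i j; rewrite !mderivC !mul0r. Qed.

(** Modulo the relation for [g], the relation for the product is [g] times the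
    relation for [f]. *)
Lemma gradients_dependent_div f g : g != 0 -> g \in gradients_dependent ->
  g * f \in gradients_dependent -> f \in gradients_dependent.
Proof.
move=> g_neq0 /gradients_dependentP gC /gradients_dependentP gfC.
apply/gradients_dependentP => i j; apply: (mulfI g_neq0).
have := gfC i j; rewrite !mderivM !mulrDl !(mulrAC _ f) gC => /addrI.
by rewrite -!mulrA.
Qed.
End DependentGradients.

Lemma mderiv_horner_alg (K : fieldType) (n : nat) (i : 'I_n)
    (h : {mpoly K[n]}) (q : {poly K}) :
  (horner_alg h q)^`M(i) = horner_alg h q^`() * h^`M(i).
Proof.
elim/poly_ind: q => [|q a IHq]; first by rewrite deriv0 !rmorph0 mderiv0 mul0r.
rewrite derivD derivC addr0 derivM derivX mulr1 !rmorphD !rmorphM /=.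
rewrite !horner_algX horner_algC mderivD mderivM IHq mderivZ.
rewrite -mpolyC1 mderivC scaler0 addr0 mulrDl.
by rewrite mulrAC.
Qed.

Section Vanishing.
Variables (K : fieldType) (n : nat).
Hypothesis charK0 : [pchar K] =i pred0.
Implicit Types f g : {mpoly K[n]}.
Variables (p : 'I_n -> K) (i0 : 'I_n).
Local Notation ell := (line p i0).

(** Vanishing to order [r] along the line: all the partial derivatives of order
    less than [r] restrict to zero. *)
Fixpoint vanish r f : Prop :=
  if r is r'.+1 then ell f = 0 /\ forall j, vanish r' f^`M(j) else True.

Lemma vanishW r f : vanish r.+1 f -> vanish r f.
Proof.
elim: r f => // r IHr f [f0 df]; split=> // j; exact/IHr/df.
Qed.

Lemma vanishD r f g : vanish r f -> vanish r g -> vanish r (f + g).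
Proof.
elim: r f g => // r IHr f g [f0 df] [g0 dg]; split=> [|j].
  by rewrite rmorphD /= f0 g0 addr0.
by rewrite mderivD; apply: IHr; [apply: df | apply: dg].
Qed.

Lemma vanishM r f g : vanish r g -> vanish r (f * g).
Proof.
elim: r f g => // r IHr f g Vg; have [g0 dg] := Vg; split=> [|j].
  by rewrite rmorphM /= g0 mulr0.
by rewrite mderivM; apply: vanishD; apply: IHr; [apply: vanishW | apply: dg].
Qed.

(** By the Leibniz rule and induction on the order: the restriction to the line
    takes values in a domain, so the factor [u] can be cancelled there. *)
Lemma vanishM_inv r u f : ell u != 0 -> vanish r (u * f) -> vanish r f.
Proof.
move=> u_neq0; elim: r f => // r IHr f [uf0 duf].
have f0 : ell f = 0.
  by move/eqP: uf0; rewrite rmorphM mulf_eq0 (negPf u_neq0) => /eqP.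
split=> // j; apply: (IHr).
have Vuf : vanish r (u * f).
  case: (r) duf => // r' duf; split=> [|k].
    by rewrite rmorphM /= f0 mulr0.
  exact/vanishW/duf.
have Vf : vanish r f by apply: (IHr).
have -> : u * f^`M(j) = (u * f)^`M(j) + (- u^`M(j)) * f.
  by rewrite mderivM mulNr addrC addKr.
by apply: vanishD; [exact: duf | exact: vanishM].
Qed.

(** Differentiating along the line costs no order of vanishing, contrary to the
    other directions. *)
Lemma vanish_mderiv r f : vanish r f -> vanish r f^`M(i0).
Proof.
elim: r f => // r IHr f [f0 df]; split=> [|j].
  by rewrite -deriv_line f0 deriv0.
by rewrite mderiv_comm; apply/IHr/df.
Qed.

Lemma vanish_eq0 r f : (msize f <= r)%N -> vanish r f -> f = 0.
Proof.
elim: r f => [|r IHr] f le_fr.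
  by move=> _; apply/eqP; rewrite -msize_poly_eq0 -leqn0.
move=> [f0 df].
have f_const : f = (f@_0)%:MP.
  apply: mderiv_eq0_const => // j; apply: IHr; [exact: msize_mderiv_ltn | apply: df].
move/eqP: f0; rewrite f_const lineC polyC_eq0 => /eqP ->.
by rewrite mpolyC0.
Qed.

(** Along a line on which [C] varies, [g] is locally a function of [C], so it is
    determined by its restriction. Algebraically: the relation between
    gradients expresses each derivative of [g] by its derivative along the line,
    so vanishing to order [r] implies vanishing to order [r.+1]. *)
Lemma line_inj_dependent C g : ell C^`M(i0) != 0 ->
  g \in gradients_dependent C -> ell g = 0 -> g = 0.
Proof.
move=> dC /gradients_dependentP gC g0.
suff Vg r : vanish r g by apply: vanish_eq0 (Vg (msize g)).
elim: r => // r IHr; split=> // j.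
apply: (vanishM_inv dC); rewrite mulrC gC mulrC.
exact/vanishM/vanish_mderiv.
Qed.
End Vanishing.

(** * Divisors of polynomials with invertible leading coefficient *)

Lemma poly_lift (S T : nzRingType) (f : S -> T) (Q : {poly T}) : f 0 = 0 ->
  (forall i, exists c, Q`_i = f c) ->
  exists Q' : {poly S}, forall i, Q`_i = f Q'`_i.
Proof.
move=> f0; elim/poly_ind: Q => [|Q c IHQ] fQ.
  by exists 0 => i; rewrite !coef0 f0.
have [|Q' defQ] := IHQ.
  by move=> i; have := fQ i.+1; rewrite coefD coefMX coefC addr0.
have [c' defc] := fQ 0; rewrite coefD coefMX coefC add0r /= in defc.
exists (Q' * 'X + c'%:P) => -[|i];
  by rewrite !coefD !coefMX !coefC /= ?add0r ?addr0.
Qed.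

Section GaussField.
Variable F : fieldType.
Implicit Types (q pi b : {poly F}) (P Q G : {poly {poly F}}).

Lemma irreducible_divisor q : (1 < size q)%N ->
  exists2 pi, irreducible_poly pi & pi %| q.
Proof.
elim: {q}(size q) {-2}q (leqnn (size q)) => [|k IHk] q le_qk q_gt1.
  by have := leq_trans q_gt1 le_qk.
have [[d [size_d d_q neq_dq]]|no_d] := classic
    (exists d : {poly F}, [/\ size d != 1%N, d %| q & ~~ (d %= q)]); last first.
  exists q => //; split=> // d size_d d_q.
  by apply/negPn/negP => neq_dq; apply: no_d; exists d.
have q_neq0 : q != 0 by rewrite -size_poly_gt0; apply: leq_trans q_gt1.
have d_gt1 : (1 < size d)%N.
  have : d != 0 by apply: contraNneq q_neq0 => d0; rewrite d0 dvd0p in d_q.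
  by rewrite -size_poly_gt0; case: (size d) size_d => [|[]].
have lt_dq : (size d < size q)%N.
  rewrite ltn_neqAle dvdp_leq // andbT.
  by apply: contra neq_dq; rewrite (dvdp_size_eqp d_q).
have [|pi irr_pi pi_d] := IHk d _ d_gt1.
  by rewrite -ltnS (leq_trans lt_dq).
by exists pi => //; apply: dvdp_trans d_q.
Qed.

(** An irreducible [pi] is still prime in [F[t][X]]: reduce the coefficients of
    [P] and [Q] modulo [pi]; if neither reduction is zero, then the product of
    their leading coefficients is not divisible by [pi]. *)
Lemma irreducible_dvd_scale pi P Q G : irreducible_poly pi ->
  P * Q = pi *: G -> (exists P', P = pi *: P') \/ (exists Q', Q = pi *: Q').
Proof.
move=> irr_pi defG.
pose modpi := map_poly (fun x => x %% pi).
pose divpi := map_poly (fun x => x %/ pi).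
have split_mod P1 : P1 = modpi P1 + pi *: divpi P1.
  apply/polyP => i; rewrite coefD coefZ !coef_map_id0 ?mod0p ?div0p //.
  by rewrite addrC mulrC -divp_eq.
set P0 := modpi P; set Q0 := modpi Q.
have [P0_eq0|P0_neq0] := eqVneq P0 0.
  left; exists (divpi P).
  by rewrite {1}(split_mod P) -/P0 P0_eq0 add0r.
have [Q0_eq0|Q0_neq0] := eqVneq Q0 0.
  right; exists (divpi Q).
  by rewrite {1}(split_mod Q) -/Q0 Q0_eq0 add0r.
have pi_neq0 : pi != 0 by apply: irredp_neq0.
have lead_mod P1 : modpi P1 != 0 ->
    ~~ (pi %| lead_coef (modpi P1)).
  rewrite -lead_coef_eq0 => nz; apply/negP => /(dvdp_leq nz).
  by rewrite leqNgt /lead_coef coef_map_id0 ?mod0p // ltn_modp pi_neq0.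
have : pi %| lead_coef P0 * lead_coef Q0.
  rewrite -lead_coefM.
  pose P1 := divpi P; pose Q1 := divpi Q.
  have -> : P0 * Q0 = pi *: (G - P1 * Q0 - P * Q1).
    have defP0 : P0 = P - pi *: P1 by rewrite {1}(split_mod P) addrK.
    have defQ0 : Q0 = Q - pi *: Q1 by rewrite {1}(split_mod Q) addrK.
    rewrite {1}defP0 mulrBl {1}defQ0 mulrBr defG -scalerAl -scalerAr.
    by rewrite !scalerBr addrAC.
  by rewrite lead_coefZ dvdp_mulr.
have cop R : ~~ (pi %| R) -> coprimep pi R.
  by rewrite irreducible_poly_coprime.
rewrite Gauss_dvdpr; last exact/cop/lead_mod.
by rewrite (negPf (lead_mod _ Q0_neq0)).
Qed.

(** Gauss's lemma for a factor [P] of a scalar multiple of [G], where [G] has an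
    invertible leading coefficient: remove the irreducible factors of the scalar
    [b] from [P] or [Q], one at a time. *)
Lemma gauss_monic b P Q G : b != 0 -> P * Q = b *: G ->
  size (lead_coef G) = 1%N -> exists P', P = lead_coef P *: P'.
Proof.
elim: {b}(size b) {-2}b (leqnn (size b)) P Q => [|k IHk] b le_bk P Q b_neq0
  defG G1.
  by move: b_neq0; rewrite -size_poly_gt0 ltnNge le_bk.
case: (ltnP 1 (size b)) => [b_gt1 | b_le1].
  have [pi irr_pi /dvdpP[b' defb]] := irreducible_divisor b_gt1.
  have pi_neq0 : pi != 0 by apply: irredp_neq0.
  have pi_inj : injective ( *:%R pi : {poly {poly F}} -> _).
    by move=> U V; rewrite -!mul_polyC; apply: mulfI; rewrite polyC_eq0.
  have b'_neq0 : b' != 0.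
    by apply: contraNneq b_neq0 => b'0; rewrite defb b'0 mul0r.
  have le_b'k : (size b' <= k)%N.
    have := irr_pi.1; move: le_bk; rewrite defb size_mul //.
    case: (size pi) => [|[|s]] //; rewrite !addnS /= ltnS => le1 _.
    by apply: leq_trans le1; rewrite leq_addr.
  have defG' : P * Q = pi *: (b' *: G) by rewrite defG defb scalerA mulrC.
  have [[P' defP]|[Q' defQ]] := irreducible_dvd_scale irr_pi defG'.
    have [] := IHk b' le_b'k P' Q b'_neq0 _ G1.
      by apply: pi_inj; rewrite -defG' defP scalerAl.
    by move=> P1 defP'; exists P1; rewrite defP lead_coefZ -scalerA -defP'.
  apply: (IHk b' le_b'k P Q' b'_neq0 _ G1).
  by apply: pi_inj; rewrite -defG' defQ scalerAr.
have b1 : size b = 1%N.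
  by apply/eqP; rewrite eqn_leq b_le1 size_poly_gt0.
have : size (lead_coef P * lead_coef Q) == 1%N.
  rewrite -lead_coefM defG lead_coefZ size_mul ?b1 ?G1 //.
  by rewrite -size_poly_gt0 G1.
rewrite size_mul_eq1 => /andP[/size_poly1P[l l_neq0 lP] _].
exists (l^-1%:P *: P).
by rewrite lP scalerA -polyCM mulfV // scale1r.
Qed.
End GaussField.

Section Dilation.
(** [dil a] is the family [a_s] of dilations of [a], a polynomial in the scaling
    parameter [s], with [a_1 = a]. It transfers Gauss's lemma from univariate
    polynomials over a field to [S], with no factorization theory for [S]. *)
Variables (S : idomainType) (dil : {rmorphism S -> {poly S}}).
Hypothesis dil1 : forall a, (dil a).[1] = a.
Implicit Types (a b : S).

Let dil_frac : {rmorphism S -> {poly {fraction S}}} :=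
  map_poly (tofrac (R := S)) \o dil.

Let tofrac_inj : injective (tofrac (R := S)).
Proof. by move=> x y /eqP; rewrite tofrac_eq => /eqP. Qed.

Let dil_frac_inj : injective dil_frac.
Proof.
move=> a b /(map_inj_poly tofrac_inj (tofrac0 _)) /(congr1 (horner^~ 1)).
by rewrite !dil1.
Qed.

(** The quotient is a polynomial in [s] over the fraction field. As the constant
    term of [b_s] is invertible in [S], it is also a power series in [s] over [S],
    so its coefficients are in [S], and [s = 1] gives the claim. *)
Lemma dilation_dvd a b : (dil b)`_0 \is a GRing.unit ->
  dil_frac b %| dil_frac a -> exists q, a = b * q.
Proof.
move=> b0 /dvdpP[Q defQ].
have [|Q' defQ'] := @poly_lift _ _ (tofrac (R := S)) Q (tofrac0 _).
  (* Solve the convolution for [Q`_k], which is multiplied by the unit. *)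
  move=> k; elim/ltn_ind: k => k IHk.
  have [c defc] := fin_all_exists (fun i : 'I_k => IHk i (ltn_ord i)).
  exists (((dil b)`_0)^-1 * ((dil a)`_k - \sum_(i < k) c i * (dil b)`_(k - i))).
  have := congr1 (fun S : {poly _} => S`_k) defQ.
  rewrite coefM big_ord_recr /= subnn /= !coef_map /=.
  under eq_bigr => i _ do rewrite defc coef_map -tofracM.
  move=> def_ak; rewrite tofracM tofracB def_ak rmorph_sum /=.
  rewrite [X in X - _]addrC addrK mulrCA.
  by rewrite -tofracM mulVr // tofrac1 mulr1.
exists Q'.[1].
have : dil a = Q' * dil b.
  apply: (map_inj_poly tofrac_inj (tofrac0 _)); rewrite rmorphM /=.
  rewrite [LHS]defQ; congr (_ * _); apply/polyP => i.
  by rewrite defQ' coef_map.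
by move/(congr1 (horner^~ 1)); rewrite hornerM !dil1 mulrC.
Qed.

Lemma dilation_monic_factor (P Q G : {poly S}) (b : S) :
  b != 0 -> P * Q = b *: G -> (dil (lead_coef P))`_0 \is a GRing.unit ->
  size (dil (lead_coef G)) = 1%N -> exists D, P = lead_coef P *: D.
Proof.
move=> b_neq0 defG lP0 lG1.
have dil_frac0 : dil_frac 0 = 0 by apply: rmorph0.
have [|||P1] := @gauss_monic _ (dil_frac b) (map_poly dil_frac P)
  (map_poly dil_frac Q) (map_poly dil_frac G).
- by rewrite -dil_frac0 (inj_eq dil_frac_inj).
- by rewrite -(rmorphM (map_poly dil_frac)) defG; apply: map_polyZ.
- by rewrite lead_coef_map_inj // size_map_inj_poly.
rewrite lead_coef_map_inj // => defP1.
have [|D defD] := @poly_lift _ _ ( *%R (lead_coef P)) P (mulr0 _).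
  move=> i; apply: (dilation_dvd lP0); apply/dvdpP.
  exists P1`_i; have := congr1 (fun S : {poly _} => S`_i) defP1.
  by rewrite coefZ coef_map mulrC.
by exists D; apply/polyP => i; rewrite coefZ.
Qed.
End Dilation.

Lemma mpoly_rmorph_ext (K : fieldType) n (S : nzRingType)
    (f g : {rmorphism {mpoly K[n]} -> S}) :
  (forall c, f c%:MP = g c%:MP) -> (forall i, f 'X_i = g 'X_i) -> f =1 g.
Proof.
move=> fgC fgX; apply: mpoly_ring_ind => // a b Ha Hb.
  by rewrite !rmorphD Ha Hb.
by rewrite !rmorphM Ha Hb.
Qed.

Section Homothety.
Variables (K : fieldType) (n : nat) (p : 'I_n -> K).
Local Notation R := {mpoly K[n]}.

(** The substitution of [p + s (x - p)] for [x]. *)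
Definition homothety : R -> {poly R} :=
  mmap (polyC \o @mpolyC n K)
    (fun i => (p i)%:MP%:P + ('X_i - (p i)%:MP)%:P * 'X).

HB.instance Definition _ := GRing.RMorphism.on homothety.

Lemma homothetyC c : homothety c%:MP = c%:MP%:P.
Proof. exact: mmapC. Qed.

Lemma homothetyX i :
  homothety 'X_i = (p i)%:MP%:P + ('X_i - (p i)%:MP)%:P * 'X.
Proof. by rewrite /homothety mmapX mmap1U. Qed.

Lemma homothety1 a : (homothety a).[1] = a.
Proof.
pose f : {rmorphism R -> R} := horner_eval 1 \o homothety.
apply: (mpoly_rmorph_ext (f := f) (g := idfun)) => [c|i] /=.
  by rewrite homothetyC /horner_eval hornerC.
by rewrite homothetyX /horner_eval hornerD hornerMX !hornerC mulr1 subrKC.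
Qed.

Lemma homothety0 a : (homothety a)`_0 = a.@[p]%:MP.
Proof.
rewrite -horner_coef0.
pose f : {rmorphism R -> R} := horner_eval 0 \o homothety.
pose g : {rmorphism R -> R} := @mpolyC n K \o meval p.
apply: (mpoly_rmorph_ext (f := f) (g := g)) => [c|i] /=.
  by rewrite homothetyC /horner_eval hornerC mevalC.
rewrite homothetyX /horner_eval hornerD hornerMX !hornerC.
by rewrite mulr0 addr0 mevalXU.
Qed.
End Homothety.

(** A factor, over the fraction field of the polynomial ring, of a polynomial
    with constant nonzero leading coefficient has polynomial coefficients: this
    is where the normality of the polynomial ring enters. The centre of the
    dilation is a point at which the leading coefficient of [P] is nonzero. *)
Lemma mpoly_monic_factor (K : fieldType) n (P Q G : {poly {mpoly K[n]}})
    (b : {mpoly K[n]}) (l : K) : [pchar K] =i pred0 ->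
  b != 0 -> P * Q = b *: G -> l != 0 -> lead_coef G = l%:MP ->
  exists D, P = lead_coef P *: D.
Proof.
move=> charK0 b_neq0 defG l_neq0 lG.
have P_neq0 : P != 0.
  apply: contraNneq b_neq0 => P0; move/eqP: defG.
  rewrite P0 mul0r eq_sym -mul_polyC mulf_eq0 polyC_eq0 => /orP[//|/eqP G0].
  by move/eqP: lG; rewrite G0 lead_coef0 eq_sym mpolyC_eq0 (negPf l_neq0).
have [p lPp] : exists p, (lead_coef P).@[p] != 0.
  by apply: meval_neq0; rewrite ?lead_coef_eq0.
apply: (dilation_monic_factor (dil := homothety p) (@homothety1 _ _ p) b_neq0 defG).
  rewrite homothety0; apply/unitrPr; exists ((lead_coef P).@[p]^-1)%:MP.
  by rewrite -mpolyCM mulfV.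
by rewrite lG /= homothetyC size_polyC mpolyC_eq0 l_neq0.
Qed.

(** * A polynomial form of Lueroth's theorem *)

Lemma ex_minimal (T : Type) (mu : T -> nat) (Q : T -> Prop) :
  (exists x, Q x) -> exists2 x, Q x & forall y, Q y -> (mu x <= mu y)%N.
Proof.
move=> [x]; elim: {x}(mu x) {-2}x (leqnn (mu x)) => [|k IHk] x le_xk Qx.
  by exists x => // y _; apply: leq_trans le_xk _.
have [[y Qy lt_yx]|min_x] := classic (exists2 y, Q y & (mu y < mu x)%N).
  by apply: (IHk y) => //; rewrite -ltnS (leq_trans lt_yx).
exists x => // y Qy; rewrite leqNgt; apply/negP => lt_yx.
by apply: min_x; exists y.
Qed.

Lemma pseudo_division (S : idomainType) (A : subringClosed S) (P G : {poly S}) :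
  P != 0 -> P \is a polyOver A -> G \is a polyOver A ->
  exists k Q W, [/\ lead_coef P ^+ k *: G = Q * P + W,
    Q \is a polyOver A, W \is a polyOver A & (size W < size P)%N].
Proof.
move=> P_neq0 AP; elim: {G}(size G) {-2}G (leqnn (size G)) => [|m IHm] G le_Gm AG.
  exists 0, 0, 0; rewrite expr0 scale1r mul0r add0r size_poly0 size_poly_gt0.
  by rewrite rpred0; split=> //; apply/eqP; rewrite -size_poly_leq0.
have [lt_GP|le_PG] := ltnP (size G) (size P).
  by exists 0, 0, G; rewrite expr0 scale1r mul0r add0r rpred0.
pose M := lead_coef G *: 'X^(size G - size P).
pose G' := lead_coef P *: G - M * P.
have G_neq0 : G != 0.
  by rewrite -size_poly_gt0; apply: leq_trans le_PG; rewrite size_poly_gt0.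
have AM : M \is a polyOver A.
  by apply: polyOverZ; [apply: (elimT polyOverP AG) | rewrite rpredX ?polyOverX].
have AG' : G' \is a polyOver A.
  by rewrite rpredB ?rpredM // polyOverZ //; apply: (elimT polyOverP AP).
have le_G'm : (size G' <= m)%N.
  apply/leq_sizeP => j le_mj; rewrite coefB coefZ -scalerAl coefZ coefXnM.
  have size_G : size G = ((size P).-1 + (size G - size P)).+1.
    by rewrite -addSn prednK ?size_poly_gt0 // subnKC.
  have [lt_jG|le_Gj] := ltnP j (size G); last first.
    rewrite !nth_default ?mulr0 ?if_same ?mulr0 ?subr0 //.
    by rewrite leq_subRL ?(leq_trans (leq_subr _ _) le_Gj) // subnK.
  have -> : j = ((size P).-1 + (size G - size P))%N.
    apply/eqP; rewrite eqn_leq -ltnS -size_G lt_jG /=.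
    by rewrite -ltnS -size_G (leq_trans le_Gm).
  rewrite ltnNge leq_addl addnK.
  have -> : G`_((size P).-1 + (size G - size P)) = lead_coef G.
    by rewrite lead_coefE {2}size_G.
  by rewrite -lead_coefE mulrC subrr.
have [k [Q [W [defG' AQ AW lt_W]]]] := IHm G' le_G'm AG'.
exists k.+1, (Q + lead_coef P ^+ k *: M), W; split=> //.
  rewrite exprSr -scalerA -[lead_coef P *: G](subrK (M * P)) -/G' scalerDr defG'.
  by rewrite addrAC scalerAl -mulrDl.
by rewrite rpredD // polyOverZ ?rpredX //; apply: (elimT polyOverP AP).
Qed.

(** The leading coefficient in [Y] of [eta(X) - eta(Y)] is a nonzero constant, so
    a divisor [D] whose [Y]-degree is full has a cofactor free of [Y], and that
    cofactor divides this constant. *)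
Lemma size_divisor_difference (K : fieldType) (eta : {poly K})
    (E D : {poly {poly K}}) : (1 < size eta)%N ->
  eta^:P - eta%:P = E * D -> (size eta <= sizeY D)%N -> size D = size eta.
Proof.
move=> eta_gt1 defED le_D.
have eta_neq0 : eta != 0 by rewrite -size_poly_gt0 ltnW.
have size_swap : size (eta%:P - eta^:P : {poly {poly K}}) = size eta.
  rewrite addrC size_addl size_opp ?size_map_polyC //.
  exact: leq_ltn_trans (size_polyC_leq1 _) _.
have lead_swap : lead_coef (eta%:P - eta^:P) = - (lead_coef eta)%:P.
  rewrite addrC lead_coefDl ?lead_coefN ?lead_coef_map_inj //.
    exact: polyC_inj.
  rewrite size_opp size_map_polyC.
  exact: leq_ltn_trans (size_polyC_leq1 _) _.
have defswap : eta%:P - eta^:P = swapXY E * swapXY D.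
  rewrite -(rmorphM swapXY) -defED (rmorphB swapXY) /=.
  by rewrite swapXY_map_polyC swapXY_polyC.
have : eta%:P - eta^:P != 0 :> {poly {poly K}}.
  by rewrite -size_poly_gt0 size_swap ltnW.
rewrite defswap mulf_eq0 negb_or => /andP[sE_neq0 sD_neq0].
have sE1 : (size (swapXY E) <= 1)%N.
  have := size_mul sE_neq0 sD_neq0; rewrite -defswap size_swap => size_eta.
  rewrite leqNgt; apply/negP => sE_gt1; move: le_D.
  rewrite sizeYE size_eta -subn1 leq_subLR; apply/negP; rewrite -ltnNge.
  by rewrite ltn_add2r.
have [e def_e] : exists e, swapXY E = e%:P.
  by exists (swapXY E)`_0; apply: size1_polyC.
have /eqP : size (e * lead_coef (swapXY D)) = 1%N.
  rewrite -[e](lead_coefC) -lead_coefM -def_e -defswap lead_swap size_opp.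
  by rewrite size_polyC lead_coef_eq0 eta_neq0.
rewrite size_mul_eq1 => /andP[/eqP e1 _].
have size_E : size E = 1%N.
  by rewrite -[E]swapXYK def_e swapXY_polyC size_map_polyC.
rewrite -size_swap -[RHS]size_opp opprB defED size_mul ?size_E //.
  by rewrite -size_poly_eq0 size_E.
by rewrite -swapXY_eq0.
Qed.

Section SubalgebraOfPolynomials.
(** [A] is a [K]-subalgebra of a domain [S], closed under the divisions that are
    possible in [S], which embeds in [K[t]] by the restriction of [ell]. *)
Variables (K : fieldType) (S : idomainType) (A : subringClosed S).
Variables (iota : {rmorphism K -> S}) (ell : {rmorphism S -> {poly K}}).
Hypothesis A_iota : forall c, iota c \in A.
Hypothesis A_div : forall a b, b != 0 -> b \in A -> b * a \in A -> a \in A.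
Hypothesis ell_iota : forall c, ell (iota c) = c%:P.
Hypothesis ell_inj : {in A, forall a, ell a = 0 -> a = 0}.
Hypothesis S_monic_factor : forall (P Q G : {poly S}) (b : S) (l : K),
  b != 0 -> P * Q = b *: G -> l != 0 -> lead_coef G = iota l ->
  exists D : {poly S}, P = lead_coef P *: D.

Local Notation "P ^ell" := (map_poly ell P) (at level 2).
Local Notation "q ^iota" := (map_poly iota q) (at level 2).

Lemma map_ell_iota (q : {poly K}) : q^iota^ell = q^:P.
Proof. by rewrite -map_poly_comp; apply: eq_map_poly => c /=; rewrite ell_iota. Qed.

Lemma horner_map_polyC_X (q : {poly K}) : q^:P.['X] = q.
Proof. exact: comp_polyXr. Qed.

(** Expand [q] in base [eta] and replace [eta(X)] by [h]. *)
Lemma mod_graph (h : S) (eta q : {poly K}) : (1 < size eta)%N ->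
  exists Q W : {poly S}, [/\ q^iota = Q * (eta^iota - h%:P) + W,
    (size W < size eta)%N & forall i, exists r : {poly K}, W`_i = r^iota.[h]].
Proof.
move=> eta_gt1.
have eta_neq0 : eta != 0 by rewrite -size_poly_gt0 ltnW.
elim: {q}(size q) {-2}q (leqnn (size q)) => [|m IHm] q le_qm.
  exists 0, 0; rewrite mul0r add0r size_poly0 size_poly_gt0; split=> //.
    by move: le_qm; rewrite size_poly_leq0 => /eqP ->; rewrite rmorph0.
  by move=> i; exists 0; rewrite rmorph0 horner0 coef0.
have [->|q_neq0] := eqVneq q 0.
  exists 0, 0; rewrite mul0r add0r size_poly0 size_poly_gt0; split=> //.
    by rewrite rmorph0.
  by move=> i; exists 0; rewrite rmorph0 horner0 coef0.
have le_divm : (size (q %/ eta)%R <= m)%N.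
  rewrite size_divp // leq_subLR; apply: leq_trans le_qm _.
  by rewrite -add1n leq_add2r -ltnS prednK // ltnW.
have [Q [W [defq lt_W coefW]]] := IHm _ le_divm.
exists (h *: Q + (q %/ eta)^iota), (h *: W + (q %% eta)^iota); split.
- rewrite mulrDl -scalerAl addrACA -scalerDr -defq addrA -mul_polyC mulrBr.
  by rewrite [h%:P * _]mulrC subrKC {1}(divp_eq q eta) rmorphD rmorphM.
- rewrite (leq_ltn_trans (size_polyD _ _)) // gtn_max.
  rewrite (leq_ltn_trans (size_scale_leq _ _)) //=.
  by rewrite size_map_poly ltn_modp.
- move=> i; have [r defr] := coefW i; exists (r * 'X + ((q %% eta)`_i)%:P).
  rewrite coefD coefZ coef_map defr rmorphD rmorphM /= map_polyX map_polyC /=.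
  by rewrite hornerD hornerMX hornerC mulrC.
Qed.

(** Let [h] have minimal degree, as a polynomial in [t], among the nonconstant
    elements of [A]. Every [graph a = a(X) - a], where [a(X)] is the image of [a]
    in [K[X]], has coefficients in [A] and the root [X = t] in [K[t]]. Let [D]
    be the minimal polynomial of [t] over the fractions of [A]; it is monic with
    coefficients in [A] and divides all the [graph a]. Some coefficient of [D] is
    not constant, so it has at least the degree of [h]; hence [D] has the degree
    of [graph h]. For [g] in [A], write [g(X)] modulo [graph h] as a polynomial in
    [X] of smaller degree with coefficients in [K[h]]. It is also congruent to [g]
    modulo [D], so it equals [g]. *)
Theorem subalgebra_monogenic : (exists2 h, h \in A & (1 < size (ell h))%N) ->
  exists2 h, h \in A & forall g, g \in A -> exists r : {poly K}, g = r^iota.[h].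
Proof.
move=> [h0 Ah0 h0_gt1].
have [|h [Ah h_gt1] h_min] := @ex_minimal S (fun a => size (ell a))
  (fun a => a \in A /\ (1 < size (ell a))%N); first by exists h0.
exists h => // g Ag.
pose graph a : {poly S} := (ell a)^iota - a%:P.
have ell_graph a : (graph a)^ell = (ell a)^:P - (ell a)%:P.
  by rewrite rmorphB /= map_ell_iota map_polyC.
have graphA a : a \in A -> graph a \is a polyOver A.
  move=> Aa; rewrite rpredB ?polyOverC //.
  by apply/polyOverP => i; rewrite coef_map; apply: A_iota.
have graph0 a : (graph a)^ell.['X] = 0.
  by rewrite ell_graph hornerD hornerN hornerC horner_map_polyC_X subrr.
have size_graph : size (graph h) = size (ell h).
  rewrite size_addl ?size_map_poly // size_opp.
  exact: leq_ltn_trans (size_polyC_leq1 _) _.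
have lead_graph : lead_coef (graph h) = iota (lead_coef (ell h)).
  rewrite lead_coefDl ?lead_coef_map // size_opp size_map_poly.
  exact: leq_ltn_trans (size_polyC_leq1 _) _.
(* The minimal polynomial of [t], cleared of denominators. *)
pose kills (P : {poly S}) := [/\ P \is a polyOver A, P != 0 & P^ell.['X] = 0].
have [|P [AP P_neq0 P0] P_min] := @ex_minimal {poly S} size kills.
  exists (graph h); split; rewrite ?graphA ?graph0 //.
  by rewrite -size_poly_gt0 size_graph ltnW.
have kills_eq0 W : W \is a polyOver A -> W^ell.['X] = 0 ->
    (size W < size P)%N -> W = 0.
  move=> AW W0 lt_WP; apply/eqP; apply: contraTT lt_WP => W_neq0.
  by rewrite -leqNgt P_min.
set b := lead_coef P.
have b_neq0 : b != 0 by rewrite lead_coef_eq0.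
have Ab : b \in A by apply: (elimT polyOverP AP _).
have [k [Q [W [defF AQ AW lt_W]]]] := pseudo_division P_neq0 AP (graphA _ Ah).
have W_eq0 : W = 0.
  apply: kills_eq0 => //; have := congr1 (fun U => U^ell.['X]) defF.
  rewrite /= map_polyZ (rmorphD (map_poly ell) (Q * P) W).
  rewrite (rmorphM (map_poly ell)) /= hornerZ graph0 mulr0 hornerD hornerM P0.
  by rewrite mulr0 add0r.
have [D defP] : exists D : {poly S}, P = b *: D.
  apply: (@S_monic_factor P Q (graph h) (b ^+ k) (lead_coef (ell h))).
  - by rewrite expf_neq0.
  - by rewrite defF W_eq0 addr0 mulrC.
  - by rewrite lead_coef_eq0 -size_poly_gt0 ltnW.
  - exact: lead_graph.
have AD : D \is a polyOver A.
  apply/polyOverP => i; apply: (A_div b_neq0 Ab).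
  by rewrite -coefZ -defP; apply: (elimT polyOverP AP _).
have lD1 : lead_coef D = 1.
  by apply: (mulfI b_neq0); rewrite -lead_coefZ -defP mulr1.
have D_neq0 : D != 0 by rewrite -lead_coef_eq0 lD1 oner_neq0.
have size_D : size D = size P by rewrite defP size_scale.
have D0 : D^ell.['X] = 0.
  have := P0; rewrite defP map_polyZ hornerZ => /eqP; rewrite mulf_eq0.
  by case/orP => [/eqP/(ell_inj Ab) b0|/eqP //]; rewrite b0 eqxx in b_neq0.
have D_dvd G : G \is a polyOver A -> G^ell.['X] = 0 ->
    exists E : {poly S}, G = E * D.
  move=> AG G0.
  have [j [E [V [defG AE AV lt_V]]]] := pseudo_division D_neq0 AD AG.
  rewrite lD1 expr1n scale1r in defG; exists E; rewrite defG (_ : V = 0) ?addr0 //.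
  apply: kills_eq0; rewrite -?size_D //.
  have := congr1 (fun U => U^ell.['X]) defG.
  by rewrite G0 rmorphD rmorphM /= hornerD hornerM D0 mulr0 add0r.
have lDell : lead_coef D^ell = 1.
  by rewrite lead_coef_map_id0 ?lD1 ?rmorph0 ?rmorph1 ?oner_neq0.
(* Otherwise [D] would be a nonzero polynomial over [K] with root [t]. *)
have [i Di_gt1] : exists i, (1 < size (ell D`_i)%R)%N.
  apply: NNPP => D_const; have := D0.
  have -> : D^ell = (map_poly (coefp 0) D^ell)^:P.
    apply/polyP => i; rewrite !coef_map /=; apply: size1_polyC.
    by rewrite leqNgt; apply/negP => Di_gt1; apply: D_const; exists i.
  rewrite horner_map_polyC_X => /(congr1 (coefp (size D^ell).-1))/eqP.
  rewrite /= coef_map_id0 ?coef0 // -lead_coefE lDell coef1 eqxx.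
  by rewrite oner_eq0.
have [E defE] := D_dvd _ (graphA _ Ah) (graph0 h).
have size_DE : size D = size (ell h).
  have <- : size D^ell = size D.
    by apply: size_map_poly_id0; rewrite lD1 rmorph1 oner_neq0.
  apply: (@size_divisor_difference _ _ E^ell) => //.
    by rewrite -(rmorphM (map_poly ell)) -defE; apply/esym/ell_graph.
  apply: leq_trans (h_min D`_i _) _.
    by split=> //; apply: (elimT polyOverP AD _).
  by rewrite -coef_map; apply: max_size_coefXY.
have [E' defE'] := D_dvd _ (graphA _ Ag) (graph0 g).
have [Q' [V [defg lt_V coefV]]] := mod_graph h (ell g) h_gt1.
have : V - g%:P = (E' - Q' * E) * D.
  by rewrite mulrBl -mulrA -defE -defE' /graph defg addrAC [_ * _ + V]addrC addrK.
have [->|E_neq0] := eqVneq (E' - Q' * E) 0.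
  rewrite mul0r => /eqP; rewrite subr_eq0 => /eqP defV.
  by have := coefV 0; rewrite defV coefC.
move/(congr1 (fun U : {poly S} => size U)) => sz; exfalso; move: sz.
rewrite size_mul // => sz.
have : (size (V - g%:P)%R < size D)%N.
  rewrite size_DE (leq_ltn_trans (size_polyD _ _)) // gtn_max lt_V size_opp.
  exact: leq_ltn_trans (size_polyC_leq1 _) _.
rewrite sz -subn1 ltn_subLR ?addn_gt0 ?size_poly_gt0 ?E_neq0 //.
by rewrite ltn_add2r ltnS leqn0 size_poly_eq0 (negPf E_neq0).
Qed.
End SubalgebraOfPolynomials.

(** * The generator and the minimal roots *)

Section Generator.
Variables (K : fieldType) (n : nat) (C : {mpoly K[n]}).
Hypothesis charK0 : [pchar K] =i pred0.

Lemma transverse_line : (forall a, C <> a%:MP) ->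
  exists p i, line p i C^`M(i) != 0.
Proof.
move=> C_nonconst.
have [i dC_neq0] : exists i, C^`M(i) != 0.
  apply: NNPP => dC0; apply: (C_nonconst C@_0).
  apply: mderiv_eq0_const => // i; apply: NNPP => /eqP dC_neq0.
  by apply: dC0; exists i.
have [p dCp] := meval_neq0 charK0 dC_neq0.
exists p, i; apply: contraNneq dCp => dC0.
by rewrite -(horner_line0 p i) dC0 horner0.
Qed.

Lemma dependent_monogenic : (forall a, C <> a%:MP) ->
  exists2 h, h \in gradients_dependent C &
    forall g, g \in gradients_dependent C ->
      exists q : {poly K}, g = horner_alg h q.
Proof.
move=> /transverse_line [p [i dC_neq0]].
have alg_mpolyC (a : K) : a%:A = a%:MP :> {mpoly K[n]}.
  by rewrite -mul_mpolyC mulr1.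
pose A : subringClosed {mpoly K[n]} := gradients_dependent C.
pose iota : {rmorphism K -> {mpoly K[n]}} := GRing.in_alg {mpoly K[n]}.
have size_C : (1 < size (line p i C))%N.
  rewrite ltnNge; apply: contra dC_neq0 => /size1_polyC C0.
  by rewrite -deriv_line C0 derivC.
have [||||||h Ah h_gen] := @subalgebra_monogenic K {mpoly K[n]} A iota (line p i).
- by move=> a; rewrite /= alg_mpolyC; apply: gradients_dependent_const.
- by move=> f g; apply: gradients_dependent_div.
- by move=> a; rewrite /= alg_mpolyC lineC.
- by move=> g gC; exact: line_inj_dependent dC_neq0 gC.
- move=> P Q G b l b_neq0 defG l_neq0; rewrite /= alg_mpolyC.
  exact: mpoly_monic_factor defG l_neq0.
- by exists C => //; apply: gradients_dependent_refl.
by exists h => // g gC; have [q ->] := h_gen g gC; exists q.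
Qed.
End Generator.

Section MinimalRoot.
Variables (K : fieldType) (n : nat).
Implicit Types h : {mpoly K[n]}.

Lemma horner_alg_comp h (q r : {poly K}) :
  horner_alg h (r \Po q) = horner_alg (horner_alg h q) r.
Proof.
elim/poly_ind: r => [|r a IHr]; first by rewrite comp_poly0 !rmorph0.
rewrite comp_polyD comp_polyC comp_polyM comp_polyX !rmorphD !rmorphM /=.
by rewrite IHr !horner_algC !horner_algX.
Qed.

Lemma horner_alg_const (a : K) (q : {poly K}) :
  horner_alg (a%:MP : {mpoly K[n]}) q = q.[a]%:MP.
Proof.
elim/poly_ind: q => [|q b IHq]; first by rewrite rmorph0 horner0.
rewrite rmorphD rmorphM /= IHq horner_algX horner_algC.
by rewrite hornerD hornerMX hornerC mpolyCD mpolyCM -mul_mpolyC mulr1.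
Qed.

Lemma msize_horner_alg h (q : {poly K}) : (1 < msize h)%N -> (1 < size q)%N ->
  (msize h <= msize (horner_alg h q))%N /\
  ((2 < size q)%N -> (msize h < msize (horner_alg h q))%N).
Proof.
move=> h_gt1; have h_neq0 : h != 0 by rewrite -msize_poly_eq0 -lt0n ltnW.
have le_addC (f : {mpoly K[n]}) a :
    (1 < msize f)%N -> (msize f <= msize (f + a%:A))%N.
  move=> f_gt1; have := mmeasureD_le mdeg (f + a%:A) (- a%:A).
  rewrite addrK mmeasureN leq_max => /orP[//|le_f1]; move: f_gt1.
  rewrite ltnNge (leq_trans le_f1) // -mul_mpolyC mulr1 mmeasureC.
  exact: leq_b1.
elim/poly_ind: q => [|q a IHq]; first by rewrite size_poly0.
rewrite size_MXaddC; case: ifP => // q_a0; rewrite ltnS => q_gt0.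
have q_neq0 : q != 0 by rewrite -size_poly_gt0.
rewrite rmorphD rmorphM /= horner_algX horner_algC ltnS.
have [q_gt1|q_le1] := ltnP 1 (size q); last first.
  split=> //; rewrite (size1_polyC q_le1) horner_algC.
  have q0_neq0 : q`_0 != 0 by rewrite -polyC_eq0 -size1_polyC.
  by rewrite -scalerAl mul1r; apply: leq_trans (le_addC _ _ _); rewrite msizeZ.
have [le_h _] := IHq q_gt1.
have Hq_gt1 : (1 < msize (horner_alg h q))%N := leq_trans h_gt1 le_h.
have lt_h : (msize h < msize (horner_alg h q * h))%N.
  rewrite msizeM //; last by rewrite -msize_poly_eq0 -lt0n ltnW.
  by case: (msize _) Hq_gt1 => [|[|s]] //= _; rewrite addSn ltnS leq_addl.
have le_hq := le_addC _ a (ltn_trans h_gt1 lt_h).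
split=> [|_]; last exact: leq_trans lt_h le_hq.
exact: leq_trans (ltnW lt_h) le_hq.
Qed.

(** By degrees [q] is affine, so it can be inverted. *)
Lemma generator_of_msize_le c h (q : {poly K}) : (forall a, c <> a%:MP) ->
  c = horner_alg h q -> (msize c <= msize h)%N ->
  exists r : {poly K}, h = horner_alg c r.
Proof.
move=> c_nonconst def_c le_ch.
have q_gt1 : (1 < size q)%N.
  rewrite ltnNge; apply/negP => /size1_polyC q0; apply: (c_nonconst q`_0).
  by rewrite def_c q0 horner_algC coefC -mul_mpolyC mulr1.
have h_gt1 : (1 < msize h)%N.
  rewrite ltnNge; apply/negP => /msize1_polyC h0.
  by apply: (c_nonconst q.[h@_0]); rewrite def_c {1}h0 horner_alg_const.
have size_q : size q = 2%N.
  apply/eqP; rewrite eqn_leq q_gt1 andbT leqNgt; apply/negP => q_gt2.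
  have [_ /(_ q_gt2)] := msize_horner_alg h_gt1 q_gt1.
  by rewrite -def_c ltnNge le_ch.
have q1_neq0 : q`_1 != 0.
  have := lead_coef_eq0 q.
  by rewrite /lead_coef size_q -size_poly_eq0 size_q /= => ->.
exists ((q`_1)^-1 *: ('X - (q`_0)%:P)).
rewrite linearZ rmorphB /= horner_algX horner_algC.
have def_q : q = (q`_0)%:P + q`_1 *: 'X.
  apply/polyP => -[|[|k]];
    rewrite coefD coefC coefZ coefX ?mulr0 ?mulr1 ?addr0 ?add0r //.
  by rewrite nth_default // size_q.
have -> : c = (q`_0)%:A + q`_1 *: h.
  rewrite def_c {1}def_q -mul_polyC rmorphD rmorphM /=.
  by rewrite !horner_algC horner_algX mulr_algl.
by rewrite [X in X - _]addrC addrK mulr_algl scalerA mulVf // scale1r.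
Qed.
End MinimalRoot.

(** * The center *)

Section Center.
Variables (K : fieldType) (n : nat).
Hypothesis n_gt0 : (0 < n)%N.
Implicit Types C g : {mpoly K[n.+1]}.

(** If the gradients are dependent then two rows of every Jacobian are dependent.
    Conversely, for distinct [i] and [j], let the functions other than [g] and [C]
    be the variables of index other than [i] and [j]. A nontrivial relation
    between the rows of that singular Jacobian must involve the gradient of [g]
    or [C], since the other rows are distinct unit vectors; its components [i] and
    [j] give the vanishing of the minor. *)
Lemma in_centerP C g : in_center C g <-> g \in gradients_dependent C.
Proof.
pose F f : 'I_n.+1 -> {mpoly K[n.+1]} := fun i =>
  if unlift ord_max i is Some j then (if j == 0%N :> nat then g else f j) else C.
have F_max f : F f ord_max = C by rewrite /F unlift_none.
have F_0 f : F f ord0 = g.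
  have -> : ord0 = lift ord_max (Ordinal n_gt0).
    by apply/val_inj; rewrite /= /bump leqNgt n_gt0.
  by rewrite /F liftK.
have neq_0max : ord0 != ord_max :> 'I_n.+1 by rewrite -val_eqE /= eq_sym -lt0n.
split=> [gC|/gradients_dependentP gC f]; last first.
  apply/eqP/det0P; rewrite -/(F f).
  have [dC0|] := boolP [forall j, C^`M(j) == 0].
    exists (delta_mx 0 ord_max).
      apply/eqP => /rowP/(_ ord_max)/eqP; rewrite !mxE !eqxx.
      by rewrite oner_eq0.
    rewrite -rowE; apply/rowP => j; rewrite !mxE.
    have := F_max f; rewrite /F => ->.
    by apply/eqP; apply: (forallP dC0).
  rewrite negb_forall => /existsP [j dCj].
  (* The linear relation with coefficients the [j]-th partial derivatives. *)
  exists (C^`M(j) *: delta_mx 0 ord0 - g^`M(j) *: delta_mx 0 ord_max).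
    apply/eqP => /rowP/(_ ord0)/eqP; rewrite !mxE !eqxx (negPf neq_0max) /=.
    by rewrite mulr1 mulr0 subr0 (negPf dCj).
  rewrite mulmxBl -!scalemxAl -!rowE; apply/rowP => k; rewrite !mxE.
  have := F_max f; have := F_0 f; rewrite /F => -> ->.
  by rewrite mulrC gC mulrC subrr.
apply/gradients_dependentP => i j.
have [->//|neq_ij] := eqVneq i j.
(* [s] sends the row of [g] to the column [i] and the row of [C] to the column
   [j]. *)
pose s := (tperm ord0 i * tperm (tperm ord0 i ord_max) j)%g.
have s_0 : s ord0 = i.
  rewrite permM tpermL tpermD // 1?eq_sym //.
  by rewrite -{1}(tpermL ord0 i) (inj_eq perm_inj).
have s_max : s ord_max = j by rewrite permM tpermL.
pose f k := 'X_(s (lift ord_max k)) : {mpoly K[n.+1]}.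
have F_s k : k != ord0 -> k != ord_max -> F f k = 'X_(s k).
  move=> k_neq0; rewrite eq_sym => /unlift_some[m def_k m_k]; rewrite /F m_k.
  rewrite ifN; first by rewrite /f -def_k.
  apply: contraNneq k_neq0 => m0; rewrite def_k -val_eqE /= m0 /bump.
  by rewrite leqNgt n_gt0.
have /eqP/det0P [v v_neq0 vM] := gC f.
have vM_col l : v 0 ord0 * g^`M(l) + (v 0 ord_max * C^`M(l) +
    \sum_(k | (k != ord0) && (k != ord_max)) v 0 k * (s k == l)%:R) = 0.
  have := congr1 (fun w : 'rV_n.+1 => w 0 l) vM; rewrite !mxE.
  rewrite (bigD1 ord0) // (bigD1 ord_max) 1?eq_sym //= !mxE.
  have := F_max f; have := F_0 f; rewrite {1 2}/F => -> -> sum0.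
  rewrite -[RHS]sum0.
  do 2![congr (_ + _)]; apply: eq_bigr => k /andP[k_neq0 k_neqmax].
  by rewrite mxE -mderiv_var -F_s.
have vM_end l : l \in [:: i; j] ->
    v 0 ord0 * g^`M(l) = - (v 0 ord_max * C^`M(l)).
  move=> l_ij; apply/eqP; rewrite -addr_eq0 -[X in _ + X]addr0; apply/eqP.
  rewrite -[RHS](vM_col l); do 2![congr (_ + _)].
  rewrite big1 // => k /andP[k_neq0 k_neqmax].
  move: l_ij; rewrite !inE -s_0 -s_max => /orP[]/eqP->.
    by rewrite (inj_eq perm_inj) (negPf k_neq0) mulr0.
  by rewrite (inj_eq perm_inj) (negPf k_neqmax) mulr0.
have [i_ij j_ij] : i \in [:: i; j] /\ j \in [:: i; j] by rewrite !inE !eqxx orbT.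
have [v0|v0_neq0] := eqVneq (v 0 ord0) 0; last first.
  apply: (mulfI v0_neq0); rewrite !mulrA !vM_end //.
  by rewrite !mulNr -!mulrA [C^`M(j) * _]mulrC.
have [vmax|vmax_neq0] := eqVneq (v 0 ord_max) 0.
  case/eqP: v_neq0; apply/rowP => k; rewrite mxE.
  have [->//|k_neq0] := eqVneq k ord0; have [->//|k_neqmax] := eqVneq k ord_max.
  have := vM_col (s k); rewrite v0 vmax !mul0r !add0r.
  rewrite (bigD1 k) ?k_neq0 //= eqxx mulr1 big1 ?addr0 // => m /andP[_ neq_mk].
  by rewrite (inj_eq perm_inj) (negPf neq_mk) mulr0.
have dC0 l : l \in [:: i; j] -> C^`M(l) = 0.
  move=> /vM_end; rewrite v0 mul0r => /esym/eqP.
  by rewrite oppr_eq0 mulf_eq0 (negPf vmax_neq0) => /eqP.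
by rewrite !dC0 ?mulr0.
Qed.
End Center.

Theorem proposition1 (K : fieldType) (charK0 : [pchar K] =i pred0)
    (n : nat) (n_ge2 : (2 <= n)%N) (C c : {mpoly K[n.+1]})
    (C_nonconstant : forall a : K, C <> a%:MP)
    (c_minroot : is_minimal_root_of c C) :
  forall g : {mpoly K[n.+1]}, in_center C g <-> in_subalg c g.
Proof.
have n_gt0 : (0 < n)%N by apply: leq_trans n_ge2.
have [[P def_C] c_min] := c_minroot.
have dep_c f : in_subalg c f -> f \in gradients_dependent C.
  move=> [q ->]; apply/gradients_dependentP => i j.
  by rewrite def_C !mderiv_horner_alg mulrACA [c^`M(i) * _]mulrC mulrACA.
have [h _ h_gen] := dependent_monogenic charK0 C_nonconstant.
have [q def_c] : exists q : {poly K}, c = horner_alg h q.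
  by apply: h_gen; apply: dep_c; exists 'X; rewrite horner_algX.
have le_ch : (msize c <= msize h)%N.
  apply: c_min; apply: h_gen; apply: dep_c; exists P; exact: def_C.
have c_nonconst a : c <> a%:MP.
  move=> def_a; apply: (C_nonconstant P.[a]).
  by rewrite def_C def_a horner_alg_const.
have [r def_h] := generator_of_msize_le c_nonconst def_c le_ch.
move=> g; rewrite in_centerP //; split=> [gC|]; last exact: dep_c.
have [u ->] := h_gen g gC.
by exists (u \Po r); rewrite horner_alg_comp -def_h.
Qed.
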